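(* Let $D$ be the unit simplex $\{(p_0,\ldots,p_K)\in[0,1]^{K+1}:\sum_k p_k=1\}$, let $Y$ be a finite set, and let $h:D\to Y$. Suppose that every level set $L(y)=\{p\in D: h(p)=y\}$, $y\in Y$, can be written as a finite union $L(y)=\bigcup_k C_{y,k}$, where each $C_{y,k}$ can in turn be written as a finite intersection of linear inequalities (on points $p \in D$) of the form $$\alpha_0p_0+\alpha_1p_1+\cdots+\alpha_Kp_K\le\alpha\quad\text{or}\quad\alpha_0p_0+\alpha_1p_1+\cdots+\alpha_Kp_K<\alpha,$$ with rational coefficients $\alpha,\alpha_0,\ldots,\alpha_K$. Then $h$ is computable.
   Context: Let $X=\{0,1,\ldots,K\}$. For $x\in X^n$, $p_k(x)=|\{i:x_i=k\}|/n$. A function $h:D\to Y$ is computable if the family $f_n:X^n\to Y$, $f_n(x)=h(p_0(x),\ldots,p_K(x))$, is computable in the following model. A network is a triple $(n,G,\mathcal L)$: $G$ is a connected undirected graph without self-arcs on $n\ge2$ nodes $\{1,\ldots,n\}$; $d(i)$ is the degree of node $i$; the port labeling $\mathcal L$ assigns to the edges at each node $i$ distinct port numbers in $\{0,1,\ldots,d(i)\}$. An algorithm is a family of deterministic finite automata $(A_d)_{d=1,2,\ldots}$, where $A_d$ is a map from $X\times Z_d\times(Y\cup\{\emptyset\})\times M^d$ into itself not changing the $X$-component. Here the internal memory set $Z_d$, the output set $Y$ and the message set $M$ are finite, $Z_d$ and $M$ contain a default symbol $\emptyset$, and $Z_d$ may depend on $d$; none of these depend on $n$. Node $i$ starts with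 initial value $x_i\in X$, with memory $z_i(0)$, output $y_i(0)$ and all outgoing messages equal to $\emptyset$. Let $j_1,\ldots,j_{d(i)}$ be the neighbors of $i$ in the order of the port numbers at $i$, and let $p_k$ be the index, in the corresponding enumeration at node $j_k$, of the edge from $j_k$ to $i$. At each time step every node $i$ updates synchronously $$[x_i,z_i(t+1),y_i(t+1);m_{i,1}(t+1),\ldots,m_{i,d(i)}(t+1)]=A_{d(i)}[x_i,z_i(t),y_i(t);m_{j_1,p_1}(t),\ldots,m_{j_{d(i)},p_{d(i)}}(t)].$$ The algorithm terminates with final output $y^*\in Y$ if there is a time $t'$ with $y_i(t)=y^*$ for all $i$ and all $t\ge t'$. The family $(f_n)$ is computable if there is a family $(A_d)$ such that for every $n$, every network with $n$ nodes, and all initial values $x_1,\ldots,x_n$, the algorithm terminates with final output $f_n(x_1,\ldots,x_n)$. *)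

(* Defs.v *)
From HB Require Import structures.
From mathcomp Require Import all_boot all_order all_algebra.
From mathcomp Require Import boolp classical_sets reals.
Set Implicit Arguments.
Unset Strict Implicit.
Unset Printing Implicit Defensive.
Import Order.TTheory GRing.Theory Num.Theory.
Local Open Scope ring_scope.

(* The port number of the edge {i, j} at node i is [port i j]; its value is
   irrelevant when i and j are not adjacent. *)
Record network (n : nat) := Network {
  adj : rel 'I_n;
  port : 'I_n -> 'I_n -> nat;
  network_size : (1 < n)%N;
  adj_sym : symmetric adj;
  adj_irr : irreflexive adj;
  adj_connected : forall i j : 'I_n, connect adj i j;
  port_bound : forall i j : 'I_n, adj i j -> (port i j <= #|adj i|)%N;
  port_inj : forall i : 'I_n, {in adj i &, injective (port i)}
}.

Section Ports.
Variables (n : nat) (N : network n).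

Definition deg (i : 'I_n) : nat := #|adj N i|.

Definition nbrs (i : 'I_n) : seq 'I_n :=
  sort (relpre (port N i) leq) (enum (adj N i)).

Lemma size_nbrs (i : 'I_n) : size (nbrs i) = deg i.
Proof. by rewrite size_sort -cardE. Qed.

Lemma mem_nbrs (i j : 'I_n) : (j \in nbrs i) = adj N i j.
Proof. by rewrite mem_sort mem_enum. Qed.

Definition nbr (i : 'I_n) (k : 'I_(deg i)) : 'I_n := nth i (nbrs i) k.

Lemma adj_nbr (i : 'I_n) (k : 'I_(deg i)) : adj N i (nbr k).
Proof. by rewrite -mem_nbrs mem_nth // size_nbrs. Qed.

Lemma back_index_subproof (i : 'I_n) (k : 'I_(deg i)) :
  (index i (nbrs (nbr k)) < deg (nbr k))%N.
Proof. by rewrite -size_nbrs index_mem mem_nbrs adj_sym adj_nbr. Qed.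

(* For j := nbr k, the index of the edge from j to i in the enumeration at j. *)
Definition back_index (i : 'I_n) (k : 'I_(deg i)) : 'I_(deg (nbr k)) :=
  Ordinal (back_index_subproof k).

End Ports.

(* [None : option Y] is the default symbol added to Y. *)
Definition node_state (X Y Z M : Type) (d : nat) : Type :=
  (X * Z * option Y * {ffun 'I_d -> M})%type.

(* The component at d = 0 is never run: every node of a network has a
   neighbor. *)
Record algorithm (X Y : finType) := Algorithm {
  memory : nat -> finType;
  message : finType;
  memory0 : forall d : nat, memory d;
  message0 : message;
  automaton : forall d : nat,
    node_state X Y (memory d) message d -> node_state X Y (memory d) message d;
  automaton_input : forall (d : nat) x z y (m : {ffun 'I_d -> message}),
    (automaton (x, z, y, m)).1.1.1 = x
}.

Section Execution.
Variables (X Y : finType) (A : algorithm X Y) (n : nat) (N : network n).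

(* The message component of a node in a configuration holds its outgoing
   messages, indexed by the enumeration of its neighbors. *)
Definition configuration : Type :=
  forall i : 'I_n, node_state X Y (memory A (deg N i)) (message A) (deg N i).

Definition initial_configuration (x : {ffun 'I_n -> X}) : configuration :=
  fun i => (x i, memory0 A (deg N i), None, [ffun=> message0 A]).

Definition step (c : configuration) : configuration :=
  fun i => automaton ((c i).1, [ffun k => (c (nbr k)).2 (back_index k)]).

Definition run (x : {ffun 'I_n -> X}) (t : nat) : configuration :=
  iter t step (initial_configuration x).

Definition output (c : configuration) (i : 'I_n) : option Y := (c i).1.2.

Definition terminates_with (x : {ffun 'I_n -> X}) (y : Y) : Prop :=
  exists t0 : nat, forall (t : nat) (i : 'I_n),
    (t0 <= t)%N -> output (run x t) i = Some y.

End Execution.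

(* [f n] is the member of the family on n.+1 initial values. *)
Definition family_computable (X Y : finType)
    (f : forall n : nat, {ffun 'I_n.+1 -> X} -> Y) : Prop :=
  exists A : algorithm X Y,
    forall (n : nat) (N : network n.+1) (x : {ffun 'I_n.+1 -> X}),
      terminates_with A N x (f n x).

Section Simplex.
Variables (R : realType) (K : nat).

Definition in_simplex (p : {ffun 'I_K.+1 -> R}) : bool :=
  [forall k, 0 <= p k <= 1] && (\sum_k p k == 1).

Definition simplex : Type := {p : {ffun 'I_K.+1 -> R} | in_simplex p}.

Definition frequency (n : nat) (x : {ffun 'I_n.+1 -> 'I_K.+1}) :
    {ffun 'I_K.+1 -> R} :=
  [ffun k => #|[set i | x i == k]|%:R / n.+1%:R].

Lemma frequency_in_simplex (n : nat) (x : {ffun 'I_n.+1 -> 'I_K.+1}) :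
  in_simplex (frequency x).
Proof.
apply/andP; split.
  apply/forallP => k; rewrite ffunE divr_ge0 //= ler_pdivrMr ?ltr0n // mul1r.
  by rewrite ler_nat (leq_trans (max_card _)) // card_ord.
under eq_bigr do rewrite ffunE.
rewrite -mulr_suml -natr_sum.
suff -> : (\sum_(k < K.+1) #|[set i | x i == k]|)%N = n.+1.
  by rewrite divff // pnatr_eq0.
rewrite -[RHS](card_ord n.+1) -sum1_card (partition_big x predT) //=.
by apply: eq_bigr => k _; rewrite -sum1_card; apply: eq_bigl => i; rewrite inE.
Qed.

Definition frequency_point (n : nat) (x : {ffun 'I_n.+1 -> 'I_K.+1}) : simplex :=
  exist _ (frequency x) (frequency_in_simplex x).

Definition computable (Y : finType) (h : simplex -> Y) : Prop :=
  family_computable (fun n x => h (@frequency_point n x)).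

Record linear_inequality := LinearInequality {
  coefs : 'I_K.+1 -> rat;
  bound : rat;
  strict : bool
}.

Definition satisfies (l : linear_inequality) (p : simplex) : Prop :=
  let v := \sum_(k < K.+1) ratr (coefs l k) * val p k in
  if strict l then v < ratr (bound l) else v <= ratr (bound l).

Local Open Scope classical_set_scope.

Definition finite_intersection_of_inequalities (C : set simplex) : Prop :=
  exists (r : nat) (l : 'I_r -> linear_inequality),
    C = \bigcap_(j in [set: 'I_r]) [set p | satisfies (l j) p].

Definition level_set (Y : finType) (h : simplex -> Y) (y : Y) : set simplex :=
  [set p | h p = y].

Definition finite_union_of_intersections (L : set simplex) : Prop :=
  exists (m : nat) (C : 'I_m -> set simplex),
    (forall k, finite_intersection_of_inequalities (C k)) /\
    L = \bigcup_(k in [set: 'I_m]) C k.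

End Simplex.

(* Main.v *)
Require Import Defs.
From HB Require Import structures.
From mathcomp Require Import all_boot all_order all_algebra.
From mathcomp Require Import boolp classical_sets reals.
From mathcomp Require Import zify.
Set Implicit Arguments.
Unset Strict Implicit.
Unset Printing Implicit Defensive.

(** Clearing denominators, each inequality becomes the question whether a sum of
    integer weights [w (x i)] is positive.  Node [i] starts with [w (x i)] tokens,
    or with [- w (x i)] holes that each absorb a token; all remaining tokens move
    at every step, each node forwarding them through its ports in cyclic order
    (the rotor-router).  A node with [d] ports then receives at most [B * d]
    tokens per step, so finite memory suffices.  In a connected graph the numbers
    of emissions are either all unbounded or all bounded, and by conservation of
    tokens they are unbounded exactly when the sum is positive.

    When the sum is not positive the tokens die out, but the nodes cannot see it
    directly, in particular when the sum is zero.  So each node also sends out one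
    probe, moving in the same way, and keeps one probe once it has emitted a token.
    If the sum is positive, every node eventually keeps a probe and the probes die
    out; otherwise some node never emits a token, and a probe moves forever.
    Hence the kind of the last emitted item is eventually the right answer. *)

(** * Unbounded sequences of natural numbers *)

Definition unbounded (u : nat -> nat) : Prop := forall M, exists t, M <= u t.

Lemma bounded_stationary (u : nat -> nat) :
  {homo u : s t / s <= t} -> ~ unbounded u ->
  exists t0, forall t, t0 <= t -> u t = u t0.
Proof.
move=> u_homo /existsNP[M uM].
have u_lt t : u t <= M.
  by rewrite leqNgt; apply/negP => /ltnW Mu; apply: uM; exists t.
have exP : exists v, `[< exists t, u t = v >] by exists (u 0); apply/asboolP; exists 0.
have leM v : `[< exists t, u t = v >] -> v <= M by move=> /asboolP[t <-].
case: (ex_maxnP exP leM) => _ /asboolP[t0 <-] max_t0.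
exists t0 => t le_t0t; apply/eqP; rewrite eqn_leq [X in _ && X]u_homo // andbT.
by apply: max_t0; apply/asboolP; exists t.
Qed.

Lemma eventually_forall (I : finType) (P : I -> nat -> Prop) :
  (forall i, exists t0, forall t, t0 <= t -> P i t) ->
  exists t0, forall i t, t0 <= t -> P i t.
Proof.
move=> /choice[T TP]; exists (\max_i T i) => i t le_t; apply: TP.
exact: leq_trans (leq_bigmax i) le_t.
Qed.

Lemma unbounded_gt (u : nat -> nat) (M : nat) :
  {homo u : s t / s <= t} -> unbounded u ->
  exists t0, forall t, t0 <= t -> M < u t.
Proof.
move=> u_homo /(_ M.+1)[t0 Mt0]; exists t0 => t /u_homo; exact: leq_trans.
Qed.

Lemma unbounded_step (u : nat -> nat) (t0 : nat) :
  unbounded u -> exists2 t, t0 <= t & u t < u t.+1.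
Proof.
move=> u_unb; apply: contrapT => noinc.
have u_le t : u (t0 + t) <= u t0.
  elim: t => [|t IH]; first by rewrite addn0.
  rewrite addnS leqNgt; apply/negP => lt_u; apply: noinc.
  by exists (t0 + t); [exact: leq_addr | exact: leq_ltn_trans lt_u].
have [t lt_t] := u_unb (\max_(s < t0.+1) u s).+1.
have [le_t | /ltnW lt_t0] := leqP t t0; last first.
  move: lt_t; rewrite -(subnKC lt_t0) ltnNge => /negP; apply.
  by rewrite (leq_trans (u_le _)) // (leq_bigmax (@ord_max t0)).
by move: lt_t; rewrite ltnNge (leq_bigmax (Ordinal (n:=t0.+1) (m:=t) le_t)).
Qed.

Lemma unbounded_sum (I : finType) (u : nat -> I -> nat) :
  unbounded (fun t => \sum_i u t i) -> exists i, unbounded (u^~ i).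
Proof.
move=> sum_unb; apply: contrapT => /forallNP bnd.
have /choice[M ltM] (i : I) : exists M, forall t, u t i <= M.
  have /existsNP[M uM] := bnd i; exists M => t.
  by rewrite leqNgt; apply/negP => /ltnW Mu; apply: uM; exists t.
have [t] := sum_unb (\sum_i M i).+1.
by rewrite ltnNge leq_sum.
Qed.

(** * Rotor-router flow on a network *)

Section Flow.
Variables (n : nat) (N : network n).

Lemma deg_gt0 (i : 'I_n) : 0 < deg N i.
Proof.
have [j neq_ij] : exists j : 'I_n, i != j.
  have n_gt1 := network_size N; have n_gt0 := ltnW n_gt1.
  have [i0 | i0] := boolP (i == 0 :> nat).
    by exists (Ordinal n_gt1); rewrite -val_eqE /= (eqP i0).
  by exists (Ordinal n_gt0); rewrite -val_eqE.
have /connectP[[|k p] /= ip jE] := adj_connected N i j.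
  by rewrite jE eqxx in neq_ij.
by apply/card_gt0P; exists k; case/andP: ip.
Qed.

Lemma sum_nbr (i : 'I_n) (f : 'I_n -> nat -> nat) :
  \sum_(k < deg N i) f (nbr k) k = \sum_(j | adj N i j) f j (index j (nbrs N i)).
Proof.
have -> : \sum_(j | adj N i j) f j (index j (nbrs N i)) =
          \sum_(j <- nbrs N i) f j (index j (nbrs N i)).
  rewrite -big_enum; apply: perm_big.
  by rewrite perm_sym /nbrs perm_sort.
rewrite (big_nth i) size_nbrs big_mkord; apply: eq_bigr => k _.
rewrite /nbr index_uniq ?size_nbrs //.
by rewrite sort_uniq enum_uniq.
Qed.

(* If [E j] is the number of tokens that the rotor-router at [j] has emitted so
   far, then [(E j + k) %/ deg j] of them left through port [k], whence
   [flow E i] tokens were sent to [i]. *)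
Definition flow (E : 'I_n -> nat) (i : 'I_n) : nat :=
  \sum_(k < deg N i) (E (nbr k) + back_index k) %/ deg N (nbr k).

Lemma flowE (E : 'I_n -> nat) (i : 'I_n) :
  flow E i =
  \sum_(j | adj N i j) (E j + index i (nbrs N j)) %/ deg N j.
Proof.
exact: (sum_nbr i (fun j _ => (E j + index i (nbrs N j)) %/ deg N j)).
Qed.

(** Hermite's identity: passing from [e] to [e.+1] drops the term [e %/ d] and gains [(e + d) %/ d],
    which is one larger. *)
Lemma sum_divn_shift (d e : nat) : 0 < d -> \sum_(k < d) (e + k) %/ d = e.
Proof.
case: d => // d _; elim: e => [|e IH].
  by rewrite big1 // => k _; rewrite add0n divn_small.
under eq_bigr => k _ do rewrite addSnnS.
rewrite -[in RHS]IH big_ord_recr [in RHS]big_ord_recl /= addn0 addnC.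
by rewrite -addSn; congr (_ + _); rewrite divnDr ?dvdnn // divnn addn1.
Qed.

Lemma sum_flow (E : 'I_n -> nat) : \sum_i flow E i = \sum_i E i.
Proof.
under eq_bigr => i _ do rewrite flowE.
rewrite (exchange_big_dep xpredT) //=; apply: eq_bigr => j _.
under eq_bigl => i do rewrite adj_sym.
rewrite -(sum_nbr j (fun _ k => (E j + k) %/ deg N j)).
exact: sum_divn_shift (deg_gt0 j).
Qed.

Lemma leq_flow (E E' : 'I_n -> nat) (i : 'I_n) :
  (forall j, E j <= E' j) -> flow E i <= flow E' i.
Proof. by move=> leE; apply: leq_sum => k _; rewrite leq_div2r // leq_add2r. Qed.

Lemma flow0 (i : 'I_n) : flow (fun=> 0) i = 0.
Proof. by rewrite /flow big1 // => k _; rewrite add0n divn_small. Qed.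

Lemma divn_incr (B d e e' k : nat) : 0 < d -> e' <= e + B * d ->
  (e' + k) %/ d <= (e + k) %/ d + B.
Proof.
move=> d_gt0 le_e'; rewrite [_ + B]addnC -divnMDl // leq_div2r //; lia.
Qed.

(** If no node emits more than [B] items per port, each edge carries at most [B]. So the bound
    passes from emissions to arrivals, which keeps the message set finite. *)
Lemma flow_incr (B : nat) (E E' : 'I_n -> nat) (i : 'I_n) :
  (forall j, E' j <= E j + B * deg N j) ->
  flow E' i <= flow E i + B * deg N i.
Proof.
move=> leE'; rewrite mulnC -[X in X * B]card_ord -sum_nat_const -big_split.
by apply: leq_sum => k _; apply: divn_incr (deg_gt0 _) (leE' _).
Qed.

(** A neighbor of [i] receives about a [1 / deg i] share of what [i] emits, and [c] allows for the
    items it keeps; then follow a path. *)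
Lemma unbounded_connected (E : nat -> 'I_n -> nat) (c : nat) :
  (forall t i, flow (E t) i <= E t.+1 i + c) ->
  (exists i, unbounded (E^~ i)) -> forall j, unbounded (E^~ j).
Proof.
move=> leE [i i_unb] j.
have /connectP[p] := adj_connected N i j.
elim: p i i_unb => [|k p IH] i i_unb /=; first by move=> _ ->.
case/andP=> ik kp jE; apply: (IH k) => // M; have [t Mt] := i_unb ((M + c) * deg N i).
exists t.+1; rewrite -(leq_add2r c); apply: leq_trans (leE t k).
rewrite flowE (bigD1 i) /=; last by rewrite adj_sym.
apply: leq_trans (leq_addr _ _).
by rewrite leq_divRL ?deg_gt0 // (leq_trans Mt) // leq_addr.
Qed.

End Flow.

(** * Tokens and holes *)

(* The cumulative numbers of tokens emitted by the nodes after [t] steps, when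
   node [i] starts with [a i] tokens and keeps the first [H i] that it gets. *)
Section Tokens.
Variables (n : nat) (N : network n) (a H : 'I_n -> nat).

Fixpoint emitted (t : nat) : 'I_n -> nat :=
  if t is t'.+1 then fun i => a i + flow N (emitted t') i - H i else fun=> 0.

Lemma emitted_homo (i : 'I_n) : {homo emitted^~ i : s t / s <= t}.
Proof.
apply: (homo_leq (r := leq)) => // [y x z|t]; first exact: leq_trans.
elim: t i => // t IH i /=; rewrite leq_sub2r // leq_add2l.
exact: leq_flow.
Qed.

Lemma emitted_incr (B t : nat) (i : 'I_n) :
  (forall j, a j <= B) -> emitted t.+1 i <= emitted t i + B * deg N i.
Proof.
move=> le_aB; elim: t i => [|t IH] i.
  rewrite /= flow0 addn0 (leq_trans (leq_subr _ _)) // (leq_trans (le_aB i)) //.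
  by rewrite leq_pmulr ?deg_gt0.
have := flow_incr i IH; rewrite -/(emitted _) [emitted t.+2]/= [emitted t.+1]/=.
lia.
Qed.

(** Only an inequality: where holes are not yet full, the truncated subtraction gives 0 instead of a
    negative balance. *)
Lemma sum_emitted (t : nat) :
  \sum_i a i + \sum_i emitted t i <= \sum_i emitted t.+1 i + \sum_i H i.
Proof.
rewrite -(sum_flow N (emitted t)) -!big_split; apply: leq_sum => i _ /=.
by rewrite [leqRHS]addnC -leq_subLR.
Qed.

Lemma emitted_unbounded_all :
  (exists i, unbounded (emitted^~ i)) -> forall j, unbounded (emitted^~ j).
Proof.
apply: (unbounded_connected (N := N) (c := \sum_i H i)) => t i.
have : H i <= \sum_i H i by rewrite (bigD1 i) //= leq_addr.
by rewrite /=; lia.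
Qed.

Lemma emitted_unbounded : \sum_i H i < \sum_i a i ->
  forall j, unbounded (emitted^~ j).
Proof.
move=> lt_Ha; apply/emitted_unbounded_all/unbounded_sum => M; exists M.
elim: M => // M IH; have := sum_emitted M; lia.
Qed.

(* Once every node has emitted a token, all the holes are full; if there were at
   least as many holes as tokens, no token is moving any more, which makes the
   same true one step earlier. *)
Lemma emitted_eq0 (t : nat) : \sum_i a i <= \sum_i H i ->
  exists i, emitted t i = 0.
Proof.
move=> le_aH; have n_gt0 : 0 < n := ltnW (network_size N).
elim: t => [|t [i it0]]; first by exists (Ordinal n_gt0).
apply: contrapT => /forallNP pos.
have sumE : \sum_i emitted t.+1 i + \sum_i H i = \sum_i a i + \sum_i emitted t i.
  rewrite -(sum_flow N (emitted t)) -!big_split.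
  by apply: eq_bigr => j _; have := pos j; rewrite /=; lia.
have le_rest : \sum_(j | j != i) emitted t j <= \sum_(j | j != i) emitted t.+1 j.
  by apply: leq_sum => j _; apply: emitted_homo.
suff : emitted t.+1 i <= 0 by rewrite leqn0 => /eqP /pos.
rewrite -it0 -(leq_add2r (\sum_(j | j != i) emitted t j)).
have le_sum : \sum_j emitted t.+1 j <= \sum_j emitted t j.
  by rewrite -(leq_add2l (\sum_j a j)) -sumE addnC leq_add2l.
have splitE (F : 'I_n -> nat) : \sum_j F j = F i + \sum_(j | j != i) F j.
  exact: bigD1.
rewrite !splitE in le_sum.
by apply: leq_trans le_sum; rewrite leq_add2l.
Qed.

(** The node given by [emitted_eq0] depends on [t]; since counts never decrease and nodes are
    finitely many, one node serves for all times. *)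
Lemma emitted_eq0_forever : \sum_i a i <= \sum_i H i ->
  exists i, forall t, emitted t i = 0.
Proof.
move=> le_aH; apply: contrapT => /forallNP pos.
have [t0 t0P] : exists t0, forall i t, t0 <= t -> 0 < emitted t i.
  apply: eventually_forall => i; have /existsNP[t0 /eqP] := pos i.
  rewrite -lt0n => it0; exists t0 => t /(@emitted_homo i); exact: leq_trans.
have [i it0] := emitted_eq0 t0 le_aH.
by have := t0P i t0 (leqnn _); rewrite it0.
Qed.

Lemma emitted_bounded : \sum_i a i <= \sum_i H i ->
  forall j, ~ unbounded (emitted^~ j).
Proof.
move=> le_aH j j_unb; have [i i0] := emitted_eq0_forever le_aH.
have [t] : exists t, 1 <= emitted t i by apply: emitted_unbounded_all; exists j.
by rewrite i0.
Qed.

End Tokens.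

(** * Probes *)

(* Every node emits one probe, and keeps one probe once its trigger [E] is
   positive: the number of moving probes is the number of nodes that have not
   kept one. *)
Section Probes.
Variables (n : nat) (N : network n) (E : nat -> 'I_n -> nat).

(** Up to the previous step [p + s] probes had arrived, so [p + s < received] says that a new one
    arrives now. Only such a probe can be kept, so [p] never decreases. *)
Fixpoint probes_kept (t : nat) : 'I_n -> nat * bool :=
  if t is t'.+1 then fun i =>
    let received := 1 + flow N (fun j => (probes_kept t' j).1) i in
    let: (p, s) := probes_kept t' i in
    let s' := s || (0 < E t i) && (p + s < received) in
    (received - s', s')
  else fun=> (0, false).

Definition probes (t : nat) (i : 'I_n) : nat := (probes_kept t i).1.
Definition kept (t : nat) (i : 'I_n) : bool := (probes_kept t i).2.

Lemma keptS (t : nat) (i : 'I_n) :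
  kept t.+1 i = kept t i ||
    (0 < E t.+1 i) && (probes t i + kept t i < 1 + flow N (probes t) i).
Proof. by rewrite /kept /probes /=; case: (probes_kept t i). Qed.

Lemma probesS (t : nat) (i : 'I_n) :
  probes t.+1 i = 1 + flow N (probes t) i - kept t.+1 i.
Proof. by rewrite keptS /kept /probes /=; case: (probes_kept t i). Qed.

Lemma probesD (t : nat) (i : 'I_n) :
  probes t.+1 i + kept t.+1 i = 1 + flow N (probes t) i.
Proof. by rewrite probesS; case: (kept _ _); lia. Qed.

(** Joint induction: the first claim gives the second at the same time, and the second gives the
    first one step later by monotonicity of [flow]. *)
Lemma probes_received (t : nat) (i : 'I_n) :
  probes t i + kept t i <= 1 + flow N (probes t) i /\
  probes t i <= probes t.+1 i.
Proof.
elim: t i => [|t IH] i.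
  by rewrite /probes /kept.
have mono u : (forall j, probes u j + kept u j <= 1 + flow N (probes u) j) ->
    forall j, probes u j <= probes u.+1 j.
  move=> le_u j; have := le_u j; rewrite probesS keptS.
  by case: (kept u j); case: (0 < E u.+1 j); case: ltnP; rewrite /=; lia.
have le_t1 j : probes t.+1 j + kept t.+1 j <= 1 + flow N (probes t.+1) j.
  by rewrite probesD leq_add2l leq_flow // => k; case: (IH k).
by split=> //; apply: mono.
Qed.

Lemma probes_homo (i : 'I_n) : {homo probes^~ i : s t / s <= t}.
Proof.
apply: (homo_leq (r := leq)) => // [y x z|t]; first exact: leq_trans.
by case: (probes_received t i).
Qed.

Lemma kept_homo (s t : nat) (i : 'I_n) : s <= t -> kept s i -> kept t i.
Proof.
move=> /subnKC <- ks; elim: (t - s) => [|u IH]; first by rewrite addn0.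
by rewrite addnS keptS IH.
Qed.

Lemma probes_incr (B t : nat) (i : 'I_n) : 0 < B ->
  probes t.+1 i <= probes t i + B * deg N i.
Proof.
move=> B_gt0; have Bd_gt0 j : 0 < B * deg N j by rewrite muln_gt0 B_gt0 deg_gt0.
elim: t i => [|t IH] i.
  by have := probesD 0 i; have := Bd_gt0 i; rewrite flow0; lia.
have := flow_incr i IH; have := probesD t i; have := probesD t.+1 i.
have := @kept_homo _ _ i (leqnSn t.+1).
by case: (kept t.+1 i) => [->//|_]; lia.
Qed.

Lemma sum_probes (t : nat) :
  \sum_i probes t.+1 i + \sum_i kept t.+1 i = n + \sum_i probes t i.
Proof.
have -> : n + \sum_i probes t i = \sum_(i < n) 1 + \sum_i flow N (probes t) i.
  by rewrite sum_flow sum1_card card_ord.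
rewrite -!big_split.
by apply: eq_bigr => i _; exact: probesD.
Qed.

Lemma probes_unbounded_all :
  (exists i, unbounded (probes^~ i)) -> forall j, unbounded (probes^~ j).
Proof.
apply: (unbounded_connected (N := N) (c := 1)) => t i.
by have := probesD t i; case: (kept _ _); lia.
Qed.

Lemma probes_unbounded :
  (exists i, forall t, E t i = 0) -> forall j, unbounded (probes^~ j).
Proof.
move=> [i Ei0]; apply/probes_unbounded_all/unbounded_sum => M; exists M.
elim: M => // M IH; have := sum_probes M.
have kept_i : kept M.+1 i = false by elim: M.+1 => // t IHt; rewrite keptS IHt Ei0.
(* Since [i] keeps nothing, at least one of the [n] probes moves at every step. *)
have : \sum_j kept M.+1 j <= n.-1.
  rewrite (bigD1 i) //= kept_i add0n.
  have -> : n.-1 = \sum_(j | j != i) 1.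
    by rewrite sum1_card cardC1 card_ord.
  by apply: leq_sum => j _; apply: leq_b1.
have := ltn_ord i; lia.
Qed.

Lemma probes_bounded (t0 : nat) :
  (forall i t, t0 <= t -> 0 < E t i) -> forall j, ~ unbounded (probes^~ j).
Proof.
move=> E_gt0 j j_unb.
have unb i : unbounded (probes^~ i) by apply: probes_unbounded_all; exists j.
have [t1 keptT] : exists t1, forall i t, t1 <= t -> kept t i.
  apply: eventually_forall => i.
  suff [t it] : exists t, kept t i by exists t => u le_t; exact: kept_homo it.
  apply: contrapT => /forallNP notkept.
  (* A probe reaches [i] after the trigger has fired, so it would be kept. *)
  have [t le_t lt_t] := unbounded_step t0 (unb i).
  have := keptS t i; have := probesD t i; rewrite (E_gt0 i _ (leqW le_t)).
  by move: (notkept t) (notkept t.+1) => /negP/negbTE-> /negP/negbTE-> /=; lia.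
(* Now all [n] probes are kept and none moves. *)
have sumE t : t1 <= t -> \sum_i probes t.+1 i = \sum_i probes t i.
  move=> le_t; have := sum_probes t.
  have -> : \sum_i kept t.+1 i = n; last by lia.
  rewrite -[RHS]card_ord -sum1_card.
  by apply: eq_bigr => i _; rewrite (keptT i _ (leqW le_t)).
have [t le_t lt_t] := unbounded_step t1 (unb j).
suff : \sum_i probes t i < \sum_i probes t.+1 i by rewrite sumE // ltnn.
rewrite (bigD1 j) //= [ltnRHS](bigD1 j) //= -addSn leq_add //.
by apply: leq_sum => i _; apply: probes_homo.
Qed.

(** * Convergence of the opinions *)

Fixpoint opinion (t : nat) (i : 'I_n) : bool :=
  if t is t'.+1 then
    if E t' i < E t i then true
    else if probes t' i < probes t i then false
    else opinion t' i
  else false.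

Lemma opinionS (t : nat) (i : 'I_n) :
  opinion t.+1 i =
    if E t i < E t.+1 i then true
    else if probes t i < probes t.+1 i then false else opinion t i.
Proof. by []. Qed.

Lemma opinion_true (t0 : nat) :
  (forall i, unbounded (E^~ i)) -> (forall i t, t0 <= t -> 0 < E t i) ->
  exists t1, forall i t, t1 <= t -> opinion t i.
Proof.
move=> E_unb E_gt0; apply: eventually_forall => i.
have [t1 t1P] := bounded_stationary (@probes_homo i) (@probes_bounded _ E_gt0 i).
have [t le_t lt_t] := unbounded_step t1 (E_unb i).
exists t.+1 => u /subnKC <-; elim: (u - _) => [|v IH].
  by rewrite addn0 opinionS lt_t.
rewrite addnS opinionS IH; case: ifP => // _.
by rewrite !t1P ?ltnn //; lia.
Qed.

Lemma opinion_false (t0 : nat) :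
  (forall i t, t0 <= t -> E t i = E t0 i) -> (exists i, forall t, E t i = 0) ->
  exists t1, forall i t, t1 <= t -> opinion t i = false.
Proof.
move=> E_stat E_eq0; apply: eventually_forall => i.
have [t le_t lt_t] := unbounded_step t0 (probes_unbounded E_eq0 i).
exists t.+1 => u /subnKC <-; elim: (u - _) => [|v IH].
  by rewrite addn0 opinionS !E_stat ?ltnn ?lt_t //; lia.
rewrite addnS opinionS IH !E_stat ?ltnn ?if_same //; lia.
Qed.

End Probes.

Lemma opinion_correct (n : nat) (N : network n) (a H : 'I_n -> nat) :
  exists t0, forall i t, t0 <= t ->
    opinion N (emitted N a H) t i = (\sum_i H i < \sum_i a i).
Proof.
have [le_aH | lt_Ha] := leqP (\sum_i a i) (\sum_i H i).
  have [t0 t0P] : exists t0, forall i t, t0 <= t ->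
      emitted N a H t i = emitted N a H t0 i.
    have /choice[T TP] (i : 'I_n) :=
      bounded_stationary (@emitted_homo _ N a H i) (@emitted_bounded _ N _ _ le_aH i).
    exists (\max_i T i) => i t le_t.
    by rewrite !(TP i) ?leq_bigmax // (leq_trans (leq_bigmax i)).
  exact: opinion_false t0P (emitted_eq0_forever _ le_aH).
have unb := emitted_unbounded N lt_Ha.
have [t0 t0P] : exists t0, forall i t, t0 <= t -> 0 < emitted N a H t i.
  apply: eventually_forall => i.
  exact: unbounded_gt (@emitted_homo _ N a H i) (unb i).
exact: opinion_true (unb) t0P.
Qed.

(** * Finite automata running one rotor-router per inequality in parallel *)

Section Algorithm.
Variables (X Y I : finType) (tokens holes : I -> X -> nat) (B : nat).
Variable decide : {ffun I -> bool} -> option Y.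
Hypothesis B_gt0 : 0 < B.
Hypothesis tokensB : forall l x, tokens l x <= B.
Hypothesis holesB : forall l x, holes l x <= B.

(* Tokens received, probes emitted, probe kept, current opinion. *)
Definition counters : Type := (nat * nat * bool * bool)%type.

Definition received (c : counters) : nat := c.1.1.1.
Definition emitted_probes (c : counters) : nat := c.1.1.2.

(** One step when [r1] tokens and [r2] probes arrive: [u - H] tokens have been emitted so far, and
    [f + s] probes had arrived before. *)
Definition update (H r1 r2 : nat) (c : counters) : counters :=
  let: (u, f, s, o) := c in
  let s' := s || (H < u + r1) && (0 < r2) in
  let f' := f + r2 + s - s' in
  (u + r1, f', s',
   if u - H < u + r1 - H then true else if f < f' then false else o).

Arguments update : simpl never.

(** Items leaving through port [k] while the number emitted rises from [e] to [e']. *)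
Definition port_count (d e e' k : nat) : nat := (e' + k) %/ d - (e + k) %/ d.

Definition outgoing (d H : nat) (c c' : counters) (k : nat) : 'I_B.+1 * 'I_B.+1 :=
  (inord (port_count d (received c - H) (received c' - H) k),
   inord (port_count d (emitted_probes c) (emitted_probes c') k)).

(* What a node remembers of the number [u] of tokens received: whether it exceeds
   the number [H] of holes, and the number of emitted tokens modulo [d]. *)
Definition compress (d H u : nat) : nat :=
  if u <= H then u else H.+1 + (u - H.+1) %% d.

(** [compress] is at most [H + d], with [H <= B]. The type ['I_d.+1] is inhabited even at [d = 0],
    as [inord] requires. *)
Definition cell (d : nat) : Type := ('I_(B + d).+1 * 'I_d.+1 * bool * bool)%type.

Definition encode (d H : nat) (c : counters) : cell d :=
  let: (u, f, s, o) := c in (inord (compress d H u), inord (f %% d), s, o).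

Definition decode (d : nat) (c : cell d) : counters :=
  let: (u, f, s, o) := c in (val u, val f, s, o).

Lemma compress_spec (d H u : nat) : 0 < d ->
  exists q, u = compress d H u + q * d /\ (0 < q -> H < compress d H u).
Proof.
move=> d_gt0; rewrite /compress; case: (leqP u H) => [_ | lt_Hu].
  by exists 0; rewrite mul0n addn0.
exists ((u - H.+1) %/ d); split; last by rewrite addSn ltnS leq_addr.
by rewrite -addnA [_ %% _ + _]addnC -divn_eq subnKC.
Qed.

Lemma compressD (d H u q : nat) : (0 < q -> H < u) ->
  compress d H (u + q * d) = compress d H u.
Proof.
case: q => [|q] Hu; first by rewrite mul0n addn0.
have {}Hu : H < u by apply: Hu.
rewrite /compress [u <= H]leqNgt Hu /= ifF; last by lia.
have -> : u + q.+1 * d - H.+1 = q.+1 * d + (u - H.+1) by lia.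
by rewrite modnMDl.
Qed.

Lemma port_countD (d e e' q k : nat) : 0 < d ->
  port_count d (e + q * d) (e' + q * d) k = port_count d e e' k.
Proof.
move=> d_gt0; rewrite /port_count [e + _]addnC [e' + _]addnC -!addnA.
by rewrite !divnMDl // subnDl.
Qed.

Lemma decode_encode (d H : nat) (c : counters) : 0 < d -> H <= B ->
  exists q1 q2,
    let: (u, f, s, o) := decode (encode d H c) in
    c = (u + q1 * d, f + q2 * d, s, o) /\ (0 < q1 -> H < u).
Proof.
case: c => [[[u f] s] o] d_gt0 le_HB.
have [q [uE Hq]] := compress_spec H u d_gt0.
have lt_u : compress d H u < (B + d).+1.
  rewrite /compress; case: (leqP u H) => [le_uH | _]; first by lia.
  by have := ltn_pmod (u - H.+1) d_gt0; lia.
have lt_f : f %% d < d.+1 by rewrite ltnS ltnW // ltn_pmod.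
exists q, (f %/ d); rewrite /= !inordK // -uE addnC -divn_eq.
by split.
Qed.

(** Stored and exact counters differ by full turns of the rotor, which affect no message. Token
    turns are dropped only if the stored count still exceeds [H], so all tests agree too. *)
Lemma update_encode (d H r1 r2 : nat) (c : counters) : 0 < d -> H <= B ->
  let c0 := decode (encode d H c) in
  encode d H (update H r1 r2 c0) = encode d H (update H r1 r2 c) /\
  forall k, outgoing d H c0 (update H r1 r2 c0) k =
            outgoing d H c (update H r1 r2 c) k.
Proof.
move=> d_gt0 le_HB c0; have [q1 [q2]] := decode_encode c d_gt0 le_HB.
rewrite -/c0; case: c0 => [[[u f] s] o] [-> Hq].
have ltHE : (H < u + q1 * d + r1) = (H < u + r1).
  case: q1 Hq => [|q1 Hq]; first by rewrite mul0n addn0.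
  by have := Hq isT; lia.
(* No truncation interferes: [q1 > 0] forces [H < u]. *)
have subE v : v = 0 \/ v = r1 -> u + q1 * d + v - H = u + v - H + q1 * d.
  case: q1 Hq {ltHE} => [|q1 Hq]; first by rewrite mul0n !addn0.
  by have := Hq isT; lia.
have sub0 := subE 0 (or_introl erefl); have {subE} subr := subE r1 (or_intror erefl).
rewrite !addn0 in sub0.
set s' := s || (H < u + r1) && (0 < r2).
have le_s' : s' <= r2 + s by rewrite /s'; case: (s); case: (H < _); case: (r2).
have fE : f + q2 * d + r2 + s - s' = f + r2 + s - s' + q2 * d by lia.
split=> [|k]; rewrite /outgoing /update /= ltHE -/s' fE.
  rewrite sub0 subr !ltn_add2r [u + _ + r1]addnAC compressD.
    by rewrite [_ + q2 * d]addnC modnMDl.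
  by move=> /Hq; lia.
by rewrite sub0 subr !port_countD.
Qed.

Definition rotor_memory (d : nat) : finType := (bool * {ffun I -> cell d})%type.
Definition rotor_message : finType := {ffun I -> 'I_B.+1 * 'I_B.+1}.

(* The boolean of the memory tells whether the node has already put its tokens
   and its probe into circulation. *)
Definition rotor_update (d : nat)
    (s : node_state X Y (rotor_memory d) rotor_message d) (l : I) : counters :=
  let: (x, (started, cells), _, m) := s in
  update (holes l x)
    ((if started then 0 else tokens l x) + \sum_(k < d) (m k l).1)
    (~~ started + \sum_(k < d) (m k l).2) (decode (cells l)).

Definition rotor_automaton (d : nat)
    (s : node_state X Y (rotor_memory d) rotor_message d) :
    node_state X Y (rotor_memory d) rotor_message d :=
  let: (x, (started, cells), _, m) := s in
  (x, (true, [ffun l => encode d (holes l x) (rotor_update s l)]),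
   decide [ffun l => (rotor_update s l).2],
   [ffun k : 'I_d =>
     [ffun l => outgoing d (holes l x) (decode (cells l)) (rotor_update s l) k]]).

Lemma rotor_input (d : nat) x z y (m : {ffun 'I_d -> rotor_message}) :
  (rotor_automaton (x, z, y, m)).1.1.1 = x.
Proof. by case: z. Qed.

Definition rotor_algorithm : algorithm X Y :=
  @Algorithm X Y rotor_memory rotor_message
    (fun d => (false, [ffun=> (inord 0, inord 0, false, false)]))
    [ffun=> (inord 0, inord 0)] rotor_automaton rotor_input.

(** * Exact description of the run *)

Section Run.
Variables (n : nat) (N : network n) (x : {ffun 'I_n -> X}).

Let a (l : I) (i : 'I_n) : nat := tokens l (x i).
Let H (l : I) (i : 'I_n) : nat := holes l (x i).
Let E (l : I) : nat -> 'I_n -> nat := emitted N (a l) (H l).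

Definition tokens_received (l : I) (t : nat) (i : 'I_n) : nat :=
  if t is t'.+1 then a l i + flow N (E l t') i else 0.

Definition history (l : I) (t : nat) (i : 'I_n) : counters :=
  (tokens_received l t i, probes N (E l) t i, kept N (E l) t i,
   opinion N (E l) t i).

Lemma history_emitted (l : I) (t : nat) (i : 'I_n) :
  received (history l t i) - H l i = E l t i.
Proof. by case: t. Qed.

(** The predicted state. Messages carry the emissions of the last step; at time 0, [t.-1 = t] makes
    them all zero. *)
Definition trace (t : nat) (i : 'I_n) :
    node_state X Y (rotor_memory (deg N i)) rotor_message (deg N i) :=
  (x i, (0 < t, [ffun l => encode (deg N i) (H l i) (history l t i)]),
   if t is 0 then None else decide [ffun l => (history l t i).2],
   [ffun k : 'I_(deg N i) => [ffun l =>
     outgoing (deg N i) (H l i) (history l t.-1 i) (history l t i) k]]).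

Lemma port_countB (d e e' k : nat) : 0 < d -> e' <= e + B * d ->
  port_count d e e' k < B.+1.
Proof. by move=> d_gt0 /(divn_incr k d_gt0); rewrite /port_count; lia. Qed.

Lemma sum_port_count (G G' : 'I_n -> nat) (i : 'I_n) :
  (forall j, G j <= G' j) ->
  flow N G i +
    \sum_(k < deg N i) port_count (deg N (nbr k)) (G (nbr k)) (G' (nbr k)) (back_index k)
  = flow N G' i.
Proof.
move=> leG; rewrite -big_split; apply: eq_bigr => k _.
by rewrite /= subnKC // leq_div2r // leq_add2r.
Qed.

Lemma historyS (l : I) (t : nat) (i : 'I_n) (m : 'I_(deg N i) -> rotor_message) :
  (forall k, m k l = outgoing (deg N (nbr k)) (H l (nbr k))
    (history l t.-1 (nbr k)) (history l t (nbr k)) (back_index k)) ->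
  history l t.+1 i =
  update (H l i) ((if 0 < t then 0 else a l i) + \sum_(k < deg N i) (m k l).1)
    (~~ (0 < t) + \sum_(k < deg N i) (m k l).2) (history l t i).
Proof.
move=> mE.
have E_le s j : E l s.-1 j <= E l s j by apply: emitted_homo; apply: leq_pred.
have F_le s j : probes N (E l) s.-1 j <= probes N (E l) s j.
  by apply: probes_homo; apply: leq_pred.
have r1E : tokens_received l t i + ((if 0 < t then 0 else a l i) +
    \sum_(k < deg N i) (m k l).1) = tokens_received l t.+1 i.
  under eq_bigr => k _.
    (* [inord] loses nothing: at most [B] tokens leave through a port in one step. *)
    rewrite mE /= !history_emitted inordK; last first.
      apply: port_countB; first exact: deg_gt0.
      case: t {mE} => [|t]; first exact: leq_addr.
      by apply: emitted_incr => j; apply: tokensB.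
    over.
  have := sum_port_count i (E_le t); rewrite /tokens_received /=.
  by case: t {mE} => [|t] /= <-; rewrite ?flow0 ?add0n ?addnA.
have r2E : probes N (E l) t i + kept N (E l) t i + (~~ (0 < t) +
    \sum_(k < deg N i) (m k l).2) = 1 + flow N (probes N (E l) t) i.
  under eq_bigr => k _.
    rewrite mE /= inordK; last first.
      apply: port_countB; first exact: deg_gt0.
      by case: t {mE r1E} => [|t]; [exact: leq_addr | exact: probes_incr].
    over.
  have := sum_port_count i (F_le t).
  case: t {mE r1E} => [|t] /= <-; last by rewrite probesD add0n addnA.
  by rewrite -[X in flow N X](_ : (fun=> 0) = _) // flow0.
move: r1E r2E; rewrite /history /update.
move: (_ + \sum_(k < deg N i) (m k l).1) (_ + \sum_(k < deg N i) (m k l).2).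
move=> r1 r2 r1E r2E.
have sE : kept N (E l) t i || (H l i < tokens_received l t i + r1) && (0 < r2) =
          kept N (E l) t.+1 i.
  rewrite keptS -r2E -(history_emitted l t.+1 i) r1E subn_gt0.
  by congr (_ || (_ && _)); lia.
rewrite sE r1E; have fE : probes N (E l) t i + r2 + kept N (E l) t i - kept N (E l) t.+1 i
  = probes N (E l) t.+1 i by rewrite probesS -r2E addnAC.
rewrite fE opinionS; congr (_, _, _, _).
by rewrite -(history_emitted l t i) -(history_emitted l t.+1 i).
Qed.

(** Induction on time: [historyS] advances the exact counters, and [update_encode] transfers the
    step to the stored ones. *)
Lemma run_trace (t : nat) (i : 'I_n) :
  @run _ _ rotor_algorithm n N x t i = trace t i.
Proof.
elim: t i => [|t IH] i.
  rewrite /run /= /initial_configuration /trace /=; congr (_, (_, _), _, _).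
    by apply/ffunP => l; rewrite !ffunE /= /compress leq0n mod0n.
  apply/ffunP => k; rewrite !ffunE; apply/ffunP => l.
  by rewrite !ffunE /outgoing /port_count !subnn.
have {}IH : @run _ _ rotor_algorithm n N x t = trace t.
  exact: functional_extensionality_dep.
rewrite /run iterS -/(@run _ _ rotor_algorithm n N x t) IH.
pose cells := [ffun l => encode (deg N i) (H l i) (history l t i)].
pose m : {ffun 'I_(deg N i) -> rotor_message} :=
  [ffun k => (trace t (nbr k)).2 (back_index k)].
pose s : node_state X Y (rotor_memory (deg N i)) rotor_message (deg N i) :=
  (x i, (0 < t, cells), (trace t i).1.2, m).
have -> : @step _ _ rotor_algorithm n N (trace t) i = rotor_automaton s by [].
have histE l : history l t.+1 i =
    update (H l i) ((if 0 < t then 0 else a l i) + \sum_(k < deg N i) (m k l).1)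
      (~~ (0 < t) + \sum_(k < deg N i) (m k l).2) (history l t i).
  by apply: historyS => k; rewrite !ffunE.
have updE l : encode (deg N i) (H l i) (rotor_update s l) =
      encode (deg N i) (H l i) (history l t.+1 i) /\
    forall k, outgoing (deg N i) (H l i) (decode (cells l)) (rotor_update s l) k =
      outgoing (deg N i) (H l i) (history l t i) (history l t.+1 i) k.
  rewrite histE /rotor_update /= ffunE.
  exact: (update_encode _ _ _ (deg_gt0 N i) (holesB l (x i))).
have opE l : (rotor_update s l).2 = (history l t.+1 i).2.
  have [/(congr1 snd)] := updE l.
  by case: (rotor_update s l) => [[[? ?] ?] ?]; case: (history l t.+1 i) => [[[? ?] ?] ?].
rewrite /trace; congr (_, (_, _), _, _).
- by apply/ffunP => l; rewrite !ffunE; case: (updE l).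
- by congr decide; apply/ffunP => l; rewrite !ffunE opE.
- apply/ffunP => k; rewrite !ffunE; apply/ffunP => l; rewrite !ffunE.
  by have [_ outE] := updE l; apply: etrans (outE k); rewrite /cells ffunE.
Qed.

End Run.

Lemma rotor_terminates (n : nat) (N : network n) (x : {ffun 'I_n -> X}) (y : Y) :
  decide [ffun l => \sum_i holes l (x i) < \sum_i tokens l (x i)] = Some y ->
  terminates_with rotor_algorithm N x y.
Proof.
move=> decE.
have [t0 t0P] : exists t0, forall l t, t0 <= t -> forall i, (history N x l t i).2 =
    (\sum_i holes l (x i) < \sum_i tokens l (x i)).
  apply: eventually_forall => l.
  have [t0 t0P] := opinion_correct N (fun i => tokens l (x i)) (fun i => holes l (x i)).
  by exists t0 => t le_t i; apply: t0P.
(* The successor excludes time 0, when the output is still [None]. *)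
exists t0.+1 => -[//|t] i lt_t; rewrite /output run_trace -decE.
by congr decide; apply/ffunP => l; rewrite !ffunE t0P // ltnW.
Qed.

End Algorithm.

(** * From rational inequalities to integer weights *)

Local Open Scope ring_scope.
Import Order.TTheory GRing.Theory Num.Theory.

Lemma rat_weights (X : finType) (q : X -> rat) :
  exists (c : rat) (a H : X -> nat), 0 < c /\
    forall x, c * q x = (a x)%:R - (H x)%:R.
Proof.
have intE (w : int) : exists a H : nat, w%:~R = a%:R - H%:R :> rat.
  case: w => m; first by exists m, 0%N; rewrite subr0.
  by exists 0%N, m.+1; rewrite sub0r NegzE mulrNz.
have den_gt0 x : 0 < (denq (q x))%:~R :> rat by rewrite ltr0z denq_gt0.
(* The product of all denominators serves as a common multiple. *)
pose c : rat := \prod_x (denq (q x))%:~R.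
have /choice[aH aHE] x : exists aH : nat * nat, c * q x = aH.1%:R - aH.2%:R.
  have [a [H E]] := intE (numq (q x) * \prod_(x' | x' != x) denq (q x')).
  exists (a, H); rewrite -E /c (bigD1 x) //= intrM rmorph_prod /= mulrAC.
  by rewrite -[X in _ * X * _]divq_num_den [_ * (_ / _)]mulrC divfK // gt_eqF.
exists c, (fun x => (aH x).1), (fun x => (aH x).2); split=> //.
exact: prodr_gt0.
Qed.

Lemma sum_frequency (R : realType) (K n : nat)
    (x : {ffun 'I_n.+1 -> 'I_K.+1}) (f : 'I_K.+1 -> R) :
  \sum_k f k * frequency R x k = (\sum_i f (x i)) / n.+1%:R.
Proof.
rewrite mulr_suml (partition_big x xpredT) //=; apply: eq_bigr => k _.
rewrite ffunE -(@eq_bigr _ _ _ _ _ _ (fun=> f k / n.+1%:R)); last first.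
  by move=> i /eqP->.
rewrite sumr_const -[RHS]mulr_natr mulrAC -mulrA; congr (_ * (_%:R / _)).
by apply: eq_card => i; rewrite !inE.
Qed.

Section Inequality.
Variables (R : realType) (K : nat) (l : linear_inequality K).

(* Each inequality is the truth value, or its negation if it is not strict, of
   the positivity of a weighted sum of the frequencies. *)
Definition slack (k : 'I_K.+1) : rat :=
  if strict l then bound l - coefs l k else coefs l k - bound l.

(** As the coordinates sum to 1, the bound can be absorbed into every coefficient. *)
Lemma satisfies_slack (p : simplex R K) :
  satisfies l p <-> (0 < \sum_k ratr (slack k) * val p k) = strict l.
Proof.
have sum1 : \sum_k val p k = 1 by case: p => p /= /andP[_ /eqP].
have sumE (b : rat) : \sum_k ratr b * val p k = ratr b.
  by rewrite -mulr_sumr sum1 mulr1.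
rewrite /satisfies /slack; case: (strict l).
  under [X in 0 < X]eq_bigr => k _ do rewrite rmorphB mulrBl.
  by rewrite sumrB sumE subr_gt0.
under [X in 0 < X]eq_bigr => k _ do rewrite rmorphB mulrBl.
by rewrite sumrB sumE subr_gt0 leNgt; split=> [/negbTE | ->].
Qed.

Lemma slack_frequency (c : rat) (a H : 'I_K.+1 -> nat) :
  0 < c -> (forall k, c * slack k = (a k)%:R - (H k)%:R) ->
  forall (n : nat) (x : {ffun 'I_n.+1 -> 'I_K.+1}),
  (0 < \sum_k ratr (slack k) * frequency R x k) =
  (\sum_i H (x i) < \sum_i a (x i))%N.
Proof.
move=> c_gt0 slackE n x.
rewrite (sum_frequency x (fun k => ratr (slack k))) pmulr_lgt0 ?invr_gt0 ?ltr0n //.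
have c'_gt0 : 0 < ratr c :> R by rewrite ltr0q.
rewrite -(pmulr_rgt0 _ c'_gt0) mulr_sumr.
have weightE k : ratr c * ratr (slack k) = (a k)%:R - (H k)%:R :> R.
  by rewrite -rmorphM slackE rmorphB /= !ratr_nat.
rewrite (eq_bigr _ (fun i _ => weightE (x i))).
by rewrite sumrB subr_gt0 -!natr_sum ltr_nat.
Qed.

End Inequality.

Theorem theorem9p3 (R : realType) (K : nat) (Y : finType)
    (h : simplex R K -> Y)
    (hlevel : forall y : Y, finite_union_of_intersections (level_set h y)) :
  computable h.
Proof.
(* [I] indexes all inequalities of all pieces of all level sets. If [q] satisfies those that [p]
   does, it lies in the piece containing [p], hence in the same level set. *)
have [I [ineq ineqP]] : exists (I : finType) (ineq : I -> linear_inequality K),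
    forall p q : simplex R K,
      (forall l, satisfies (ineq l) p -> satisfies (ineq l) q) -> h p = h q.
  pose levels y := cid (hlevel y).
  pose pieces y := cid (svalP (levels y)).
  pose faces y (k : 'I_(sval (levels y))) := cid ((svalP (pieces y)).1 k).
  pose normals y k := cid (svalP (faces y k)).
  exists {y : Y & {k : 'I_(sval (levels y)) & 'I_(sval (faces y k))}}.
  exists (fun l => sval (normals _ (tag (tagged l))) (tagged (tagged l))) => p q pq.
  have : level_set h (h p) p by [].
  rewrite (svalP (pieces (h p))).2 => -[k _].
  rewrite (svalP (normals (h p) k)) => kp.
  suff : level_set h (h p) q by [].
  rewrite (svalP (pieces (h p))).2; exists k => //.
  rewrite (svalP (normals (h p) k)) => j _; apply: (pq (Tagged _ (Tagged _ j))).
  exact: kp.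
have /choice[c /choice[a /choice[H /all_and2[c_gt0 slackE]]]] l :=
  rat_weights (slack (ineq l)).
pose bits (p : simplex R K) : {ffun I -> bool} :=
  [ffun l => 0 < \sum_k ratr (slack (ineq l) k) * val p k].
have bitsP p q : bits p = bits q -> h p = h q.
  move=> pq; apply: ineqP => l /satisfies_slack lp; apply/satisfies_slack.
  by have /ffunP/(_ l) := pq; rewrite !ffunE -lp.
(* By [bitsP] any point with these bits will do; bits realized by no point get the default
   [None]. *)
pose decide b : option Y :=
  if pselect (exists p, bits p = b) is left ex then Some (h (sval (cid ex))) else None.
have decideE p : decide (bits p) = Some (h p).
  rewrite /decide; case: pselect => [ex|[]]; last by exists p.
  by case: (cid ex) => q /= /bitsP->.
(* The successor ensures [0 < B]. *)
pose B := (\max_l \max_k maxn (a l k) (H l k)).+1%N.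
have le_B l k : (a l k <= B)%N /\ (H l k <= B)%N.
  apply/andP; rewrite -geq_max; apply: leqW.
  apply: (leq_trans (leq_bigmax (F := fun k => maxn (a l k) (H l k)) k)).
  exact: (leq_bigmax (F := fun l => \max_k maxn (a l k) (H l k)) l).
exists (rotor_algorithm a H B decide) => n N x.
apply: rotor_terminates => // [l k|l k|]; try by case: (le_B l k).
rewrite -decideE; congr decide; apply/ffunP => l; rewrite !ffunE.
by rewrite -(slack_frequency R (c_gt0 l) (slackE l)).
Qed.
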